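(* Let $n\in\mathbb{N}$ and $\varepsilon>0$ be given. If $n\geqslant 2$ and $\varepsilon<\frac{1}{3600\,n^{11}}$, then every finite unitary group $\mathcal{G}\subseteq M_n(\mathbb{C})$ with a weak $\varepsilon$-approximate fixed point is reducible.
   Context: A unitary group $\mathcal{G}\subseteq M_n(\mathbb{C})$ is a group of unitary $n\times n$ complex matrices. $\mathbb{C}^n$ carries the standard inner product and $\|\cdot\|$ is the Euclidean norm. For $0<\varepsilon<1$, a vector $\xi\in\mathbb{C}^n$ with $\|\xi\|=1$ is a weak $\varepsilon$-approximate fixed point of $\mathcal{G}$ if $|\langle G\xi,\xi\rangle|\geqslant 1-\varepsilon$ for all $G\in\mathcal{G}$. $\mathcal{G}$ is reducible if there is a subspace of $\mathbb{C}^n$, different from $\{0\}$ and $\mathbb{C}^n$, that is invariant under every $G\in\mathcal{G}$. *)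

(* Defs.v *)
From HB Require Import structures.
From mathcomp Require Import all_boot all_order all_algebra.
From mathcomp Require Import all_classical all_reals.
From mathcomp Require Export complex.

Set Implicit Arguments.
Unset Strict Implicit.
Unset Printing Implicit Defensive.

Import Order.TTheory GRing.Theory Num.Theory.
Local Open Scope ring_scope.
Local Open Scope complex_scope.

(* Vectors of C^n are columns, and matrices act on them from the left. *)

Definition inner (R : realType) (n : nat) (x y : 'cV[R[i]]_n) : R[i] :=
  \sum_(k < n) x k 0 * Num.conj (y k 0).

Definition enorm (R : realType) (n : nat) (x : 'cV[R[i]]_n) : R[i] :=
  sqrtC (inner x x).

Definition unitary_group (R : realType) (n : nat) (G : set 'M[R[i]]_n) : Prop :=
  [/\ forall A, G A -> A \is unitarymx,
      G 1%:M,
      forall A B, G A -> G B -> G (A *m B)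
    & forall A, G A -> G (invmx A)].

(* [`| z |] lies in R[i]; the order of R[i] compares real parts of numbers
   with equal imaginary part, so the inequality below is one between reals. *)
Definition weak_approx_fixed_point (R : realType) (n : nat)
    (G : set 'M[R[i]]_n) (eps : R) (xi : 'cV[R[i]]_n) : Prop :=
  enorm xi = 1 /\
  forall A, G A -> (1 - eps)%:C <= `| inner (A *m xi) xi |.

Definition reducible (R : realType) (n : nat) (G : set 'M[R[i]]_n) : Prop :=
  exists U : {vspace 'cV[R[i]]_n},
    [/\ U != 0%VS, U != fullv
      & forall A x, G A -> x \in U -> A *m x \in U].

(* Main.v *)
Require Import Defs.
From mathcomp Require Import all_boot all_order all_algebra.
From mathcomp Require Import all_classical all_reals.
From mathcomp Require Import lra.
Import Order.TTheory GRing.Theory Num.Theory.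
Local Open Scope ring_scope.
Local Open Scope sesquilinear_scope.

(** Suppose that [G] is irreducible, and sum over the group the rank-one
    matrices [(g x) (g x)^t*].  Translation invariance makes this operator [S]
    commute with [G], so it is a scalar by Schur's lemma
    ([reducible_or_scalar], [sum_orbit_projections_commute]).  Comparing its
    trace [#|G| * <x, x>] with the quadratic form [<S x, x>], which is the sum of
    [`|<g x, x>| ^+ 2], gives the Schur orthogonality relation
    ([reducible_or_orthogonality]): for a unit vector [x], the mean of
    [`|<g x, x>| ^+ 2] over [G] is [n^-1].  For a weak approximate fixed point
    every term is at least [(1 - eps) ^+ 2], hence
    [(1 - eps) ^+ 2 <= n^-1 <= 1/2], which is absurd already for
    [eps < 1/4]. *)

Lemma inner_mxtrace (R : realType) (n : nat) (x y : 'cV[R[i]]_n) :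
  inner x y = \tr (x *m y^t*).
Proof. by apply: eq_bigr => k _; rewrite mxE big_ord1 !mxE. Qed.

Lemma adjoint_mul_col (R : realType) (n : nat) (x y : 'cV[R[i]]_n) :
  y^t* *m x = (inner x y)%:M.
Proof. by rewrite [LHS]mx11_scalar -trace_mx11 mxtrace_mulC -inner_mxtrace. Qed.

Lemma inner_conj (R : realType) (n : nat) (x y : 'cV[R[i]]_n) :
  inner y x = (inner x y)^*.
Proof.
by rewrite rmorph_sum; apply: eq_bigr => k _; rewrite rmorphM /= conjCK mulrC.
Qed.

Lemma inner_unitary (R : realType) (n : nat) (g : 'M[R[i]]_n)
    (x y : 'cV[R[i]]_n) :
  g \is unitarymx -> inner (g *m x) (g *m y) = inner x y.
Proof.
move=> g_unitary.
rewrite !inner_mxtrace trmx_mul map_mxM mulmxA mxtrace_mulC.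
by rewrite -invmx_unitary // -(mulmxA g) mulKmx ?unitarymx_unit.
Qed.

Lemma mxtrace_projections (R : realType) (n : nat) (x y : 'cV[R[i]]_n) :
  \tr (y *m y^t* *m (x *m x^t*)) = `|inner y x| ^+ 2.
Proof.
rewrite mulmxA -(mulmxA y) adjoint_mul_col mul_mx_scalar -scalemxAl mxtraceZ.
by rewrite -inner_mxtrace normCK inner_conj mulrC.
Qed.

(** Schur's lemma: an eigenspace of an operator commuting with [G] is invariant
    under [G], so for irreducible [G] it is the whole space. *)
Lemma reducible_or_scalar (R : realType) (n : nat) (G : set 'M[R[i]]_n)
    (S : 'M[R[i]]_n) :
  (0 < n)%N -> (forall g, G g -> S *m g = g *m S) ->
  reducible G \/ exists a, S = a%:M.
Proof.
move=> n_gt0 S_comm.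
(* Eigenvectors of matrices are rows, hence the transposition. *)
have [a /eigenvalueP[v Sv v_neq0]] := eigenvalue_closed S^T n_gt0.
pose U := lker (linfun (mulmx (S - a%:M) : 'cV_n -> 'cV_n)).
have inU x : (x \in U) = (S *m x == a *: x).
  by rewrite memv_ker lfunE /= mulmxBl mul_scalar_mx subr_eq0.
have [U_full|U_proper] := eqVneq U fullv.
  right; exists a; apply/matrixP => i j.
  have : delta_mx j 0 \in U by rewrite U_full memvf.
  rewrite inU => /eqP/colP/(_ i).
  by rewrite -colE !mxE eqxx andbT mulr_natr.
left; exists U; split=> //; last first.
  move=> g x Gg; rewrite !inU => /eqP Sx.
  by rewrite mulmxA S_comm // -mulmxA Sx scalemxAr.
have : v^T \in U by rewrite inU -[S]trmxK -trmx_mul Sv linearZ.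
by apply: contraTneq => ->; rewrite memv0 trmx_eq0.
Qed.

(** Left translation by [h] permutes [s] and turns the sum [S] into
    [h *m S *m h^t*]. *)
Lemma sum_orbit_projections_commute (R : realType) (n : nat)
    (s : seq 'M[R[i]]_n) (h : 'M[R[i]]_n) (x : 'cV[R[i]]_n) :
  uniq s -> h \is unitarymx -> (forall g, g \in s -> h *m g \in s) ->
  let S := \sum_(g <- s) (g *m x) *m (g *m x)^t* in S *m h = h *m S.
Proof.
move=> s_uniq h_unitary hs S.
have h_unit := unitarymx_unit h_unitary.
have hs_perm : perm_eq s [seq h *m g | g <- s].
  rewrite perm_sym; have hs_uniq : uniq [seq h *m g | g <- s].
    by rewrite map_inj_uniq //; apply: can_inj (mulKmx h_unit).
  apply: uniq_perm => //.
  apply: (uniq_min_size hs_uniq _ _).2; last by rewrite size_map.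
  by move=> _ /mapP[g /hs hg ->].
have S_conj : S = h *m S *m h^t*.
  rewrite {1}/S (perm_big _ hs_perm) big_map /= mulmx_sumr mulmx_suml.
  apply: eq_bigr => g _.
  by rewrite -(mulmxA h g x) [(h *m (g *m x))^T]trmx_mul map_mxM !mulmxA.
by rewrite {1}S_conj mulmxKtV.
Qed.

(** The relation comes from computing twice the scalar [a] by which the sum [S]
    of the matrices [(g x) (g x)^t*] acts: [a * n] is the trace of [S], a sum of
    terms [<g x, g x> = <x, x>], while [a * <x, x> = <S x, x>] is the sum of the
    [`|<g x, x>| ^+ 2]. *)
Lemma reducible_or_orthogonality (R : realType) (n : nat)
    (G : set 'M[R[i]]_n) (s : seq 'M[R[i]]_n) (x : 'cV[R[i]]_n) :
  (0 < n)%N -> unitary_group G -> uniq s -> (forall g, G g <-> g \in s) ->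
  reducible G \/
  n%:R * (\sum_(g <- s) `|inner (g *m x) x| ^+ 2)
    = (size s)%:R * inner x x ^+ 2.
Proof.
move=> n_gt0 [G_unitary _ G_mul _] s_uniq Gs.
pose S := \sum_(g <- s) (g *m x) *m (g *m x)^t*.
have S_comm g : G g -> S *m g = g *m S.
  move=> Gg; apply: sum_orbit_projections_commute (G_unitary _ Gg) _ => // k.
  by move=> /Gs Gk; apply/Gs; apply: G_mul.
have [|[a Sa]] := reducible_or_scalar _ _ G S n_gt0 S_comm; first by left.
right; have tr_S : a * n%:R = (size s)%:R * inner x x.
  rewrite mulr_natr -mxtrace_scalar -Sa raddf_sum /=.
  rewrite (eq_big_seq (fun=> inner x x)) => [|g /Gs/G_unitary g_unitary].
    by rewrite big_const_seq count_predT iter_addr_0 mulr_natl.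
  by rewrite -inner_mxtrace inner_unitary.
have -> : \sum_(g <- s) `|inner (g *m x) x| ^+ 2 = a * inner x x.
  rewrite inner_mxtrace -mxtraceZ -mul_scalar_mx -Sa mulmx_suml raddf_sum /=.
  by apply: eq_bigr => g _; rewrite mxtrace_projections.
by rewrite mulrA (mulrC n%:R) tr_S -mulrA.
Qed.

Theorem theorem6p1 (R : realType) (n : nat) (eps : R) :
  0 < eps -> (2 <= n)%N -> eps < 1 / (3600 * n%:R ^+ 11) ->
  forall G : set 'M[R[i]]_n,
    finite_set G -> unitary_group G ->
    (exists xi : 'cV[R[i]]_n, weak_approx_fixed_point G eps xi) ->
    reducible G.
Proof.
move=> eps_gt0 n_ge2 eps_small G /finite_seqP[s0 G_s0] G_group.
move=> [x [x_norm x_fixed]].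
have x_unit : inner x x = 1 by rewrite -[LHS]sqrtCK -/(enorm x) x_norm expr1n.
have Gs g : G g <-> g \in undup s0 by rewrite mem_undup G_s0.
have n_gt0 : (0 < n)%N by apply: leq_trans n_ge2.
have [//|] :=
  reducible_or_orthogonality _ _ G _ x n_gt0 G_group (undup_uniq s0) Gs.
set s := undup s0 in Gs *; rewrite x_unit expr1n mulr1 => orth.
have eps_lt : eps < 1 / 4.
  have n11_ge1 : (1 : R) <= n%:R ^+ 11 by rewrite exprn_ege1 // ler1n.
  by apply: lt_le_trans eps_small _; rewrite ler_pM2l // lef_pV2 ?posrE; lra.
have s_gt0 : (0 < size s)%N.
  case: G_group => _ /Gs; by case: (s).
suff : ((size s)%:R < (size s)%:R :> R[i]) by rewrite ltxx.
rewrite -[X in _ < X]orth.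
have term_bound g :
    g \in s -> ((1 - eps) ^+ 2)%:C%C <= `|inner (g *m x) x| ^+ 2.
  move=> /Gs/x_fixed; rewrite rmorphXn /=; apply: lerXn2r.
    by rewrite nnegrE ler0c; lra.
  by rewrite nnegrE normr_ge0.
have bound : (size s)%:R * ((1 - eps) ^+ 2)%:C%C
    <= \sum_(g <- s) `|inner (g *m x) x| ^+ 2.
  rewrite mulr_natl -iter_addr_0 -(count_predT s) -big_const_seq.
  by rewrite big_seq [leRHS]big_seq; apply: ler_sum.
apply: lt_le_trans (ler_wpM2l (ler0n _ n) bound).
rewrite mulrCA -[ltLHS]mulr1 ltr_pM2l ?ltr0n //.
have two_terms : 1 < 2 * (1 - eps) ^+ 2 by nra.
rewrite -(rmorph_nat (real_complex R)) -rmorphM -(rmorph1 (real_complex R)) ltcR.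
apply: lt_le_trans two_terms _.
by rewrite ler_wpM2r ?sqr_ge0 // ler_nat.
Qed.
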